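(* Let $n\geq 5$, let $m$ be an odd integer with $n\geq m\geq 3$, and let $\mathcal{C}$ be a real conjugacy class of cycles of length $m$ in $\mathbb{S}_n$ or in $\mathbb{A}_n$. Then the Killing form $K_{\mathcal{C}}$ is non-degenerate.
   Context: $\mathbb{S}_n$ and $\mathbb{A}_n$ are the symmetric and alternating groups on $\{1,\dots,n\}$. A conjugacy class is real if it is stable under inversion. For a subset $\mathcal{C}\subset G\setminus\{1\}$ of a finite group $G$ stable under conjugation by $G$, let $\mathbb{C}\mathcal{C}$ be the complex vector space with basis $\mathcal{C}$. The Killing form $K_{\mathcal{C}}$ is the bilinear form on $\mathbb{C}\mathcal{C}$ given on basis elements $a,b\in\mathcal{C}$ by $K_{\mathcal{C}}(a,b)=|C_G(ab)\cap\mathcal{C}|$, where $C_G(ab)$ is the centralizer of $ab$ in $G$. It is non-degenerate if the matrix $(K_{\mathcal{C}}(a,b))_{a,b\in\mathcal{C}}$ is invertible. Here $G$ is the group ($\mathbb{S}_n$ or $\mathbb{A}_n$) in which $\mathcal{C}$ is a conjugacy class. *)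

(* Defs.v *)
From HB Require Import structures.
From mathcomp Require Import all_boot all_order all_algebra all_fingroup.
From mathcomp Require Import all_solvable.
From mathcomp Require Import reals.
From mathcomp Require Import complex.

Set Implicit Arguments.
Unset Strict Implicit.
Unset Printing Implicit Defensive.

Import GRing.Theory.
Local Open Scope ring_scope.

Section KillingForm.

Variables (F : fieldType) (gT : finGroupType) (G : {group gT}) (C : {set gT}).

(* The vector space over F with basis C. *)
Definition class_space := {ffun {x : gT | x \in C} -> F}.

Definition class_basis (a : {x : gT | x \in C}) : class_space :=
  [ffun x => (x == a)%:R].

Definition killing_coef (a b : gT) : nat := #|('C_G[a * b] :&: C)%g|.

Definition killing_form (u v : class_space) : F :=
  \sum_a \sum_b u a * v b * (killing_coef (val a) (val b))%:R.

Definition killing_mx : 'M[F]_#|{: {x : gT | x \in C}}| :=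
  \matrix_(i, j) killing_form (class_basis (enum_val i))
                              (class_basis (enum_val j)).

Definition killing_nondegenerate : bool := killing_mx \in unitmx.

Lemma killing_form_basis (a b : {x : gT | x \in C}) :
  killing_form (class_basis a) (class_basis b)
  = (killing_coef (val a) (val b))%:R.
Proof.
rewrite /killing_form (bigD1 a) //= (bigD1 b) //= !ffunE !eqxx !mul1r.
rewrite big1 => [|j nj]; last by rewrite !ffunE (negPf nj) mulr0 mul0r.
rewrite big1 ?addr0 // => i ni; apply: big1 => j _.
by rewrite !ffunE (negPf ni) !mul0r.
Qed.

Lemma killing_mxE i j :
  killing_mx i j = (killing_coef (val (enum_val i)) (val (enum_val j)))%:R.
Proof. by rewrite mxE killing_form_basis. Qed.

End KillingForm.

Definition real_class (gT : finGroupType) (C : {set gT}) : Prop :=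
  {in C, forall x, x^-1%g \in C}.

(* s is the cycle (c_1 c_2 ... c_m); [next c] fixes every point outside c. *)
Definition is_cycle (T : finType) (m : nat) (s : {perm T}) : Prop :=
  exists c : seq T, [/\ uniq c, size c = m & s =1 next c].

(* Main.v *)
Require Import Defs.
From mathcomp Require Import all_boot all_order all_algebra all_fingroup.
From mathcomp Require Import all_solvable.
From mathcomp Require Import reals.
From mathcomp Require Import complex.
From mathcomp Require Import zify.

(** The group G acts by conjugation on the space with basis C; let P_a be the
    permutation matrix of a.  Then K(a, b) is the trace of P_a P_b.  Since C is
    stable under inversion, a vector lam can be paired with
    mu_b = conj (lam_(b^-1)), and the value of K on the pair (lam, mu) is the
    squared Frobenius norm of the sum of the lam_a P_a.  So lam is in the
    kernel of K only if the sum of lam over { b in C | x ^ b = y } is zero for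
    all x and y in C, and it remains to see that these conditions force lam = 0
    ([killing_nondegenerate_of_coset_sums]).

    Each such set { b | x ^ b = x ^ a } is a coset of the centralizer of x.  If
    a is its only element in C, then lam a = 0 ([coset_singleton_eq0]).  To
    find a suitable x, write a as a cycle (f 0, f 1, ...) and let x run through
    the same points in another cyclic order f (pi 0), f (pi 1), ...  On these
    points an element b of the coset is x^k followed by a, for some k modulo m.
    If b has a fixed point there, or interchanges two points, it is not an
    m-cycle that moves these points, because m is odd.  Hence x isolates a as
    soon as every shift k other than 0 is ruled out in this way
    ([conj_rigid]), which is a condition on pi alone.

    For m >= 9, number the points along x by residues modulo m.  If a visits
    them in the zigzag order 0, 1, -1, 2, -2, ..., then its steps, that is the
    differences between consecutive numbers, take all odd values below m,
    which rules out half of the shifts by fixed points, and in nearly all the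
    others two points are interchanged.  One shift survives, and it
    disappears if the order is changed near its start, to 0, 1, 2, -1, -2, 3,
    -3, ... or to 0, -1, 2, 1, -2, 3, -3, ... ([zigzag_broken]).  The two
    orders differ by exchanging 1 and -1, so they yield elements x conjugate
    under a transposition, and one of them is conjugate to a in the
    alternating group; this takes care of the alternating groups whose
    classes of m-cycles are half a class of the symmetric group.  For m = 7 a
    relabelling by a 3-cycle works.

    For m = 5 and m = 3 the coset can be made to contain just two elements of
    C, namely a and its conjugate by a 3-cycle g.  This gives
    lam a = - lam (a ^ g), and three applications give lam a = - lam a
    ([eq_opp3]).  For m = 3 this uses two points not moved by a, hence n >= 5.
    *)

Set Implicit Arguments.
Unset Strict Implicit.
Unset Printing Implicit Defensive.
Import Order.TTheory GRing.Theory Num.Theory.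

(** * From the Killing form to sums over cosets of centralizers *)

Section Killing.

Local Open Scope ring_scope.

Variables (F : numClosedFieldType) (gT : finGroupType) (G : {group gT}).
Variable C : {set gT}.
Hypotheses (subCG : C \subset G) (CV : real_class C).
Hypothesis CJ : forall x g, x \in C -> g \in G -> (x ^ g)%g \in C.

(** This is the trace of P_(ab) expanded as the trace of P_a P_b: the only
    possible y is x ^ a. *)
Lemma killing_coef_sum a b : a \in C ->
  (killing_coef G C a b)%:R
  = \sum_(x in C) \sum_(y in C) ((x ^ a)%g == y)%:R * ((y ^ b)%g == x)%:R :> F.
Proof.
move=> aC; rewrite /killing_coef -sum1_card natr_sum.
transitivity (\sum_(x in C) ((x ^ (a * b))%g == x)%:R : F).
  rewrite (eq_bigl (fun x => (x \in C) && ((x ^ (a * b))%g == x))).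
    by rewrite big_mkcondr; apply: eq_bigr => x _; case: eqP.
  move=> x; rewrite !in_setI [in RHS]andbC; case xC: (x \in C); rewrite ?andbF //.
  rewrite (subsetP subCG x xC) !andbT /=.
  by apply/cent1P/eqP => [/commgP/conjg_fixP | /conjg_fixP/commgP].
apply: eq_bigr => x xC; rewrite (bigD1 (x ^ a)%g) /=; last first.
  exact: CJ (subsetP subCG _ aC).
rewrite eqxx mul1r conjgM big1 ?addr0 // => y /andP[_ /negPf].
by rewrite eq_sym => ->; rewrite mul0r.
Qed.

(** Evaluating K on lam and the vector mu below gives the sum of the squared
    absolute values of all the S x y, the entries of the matrix sum of the
    lam_a P_a.  Stability under inversion is what puts mu on C. *)
Lemma killing_null_vanish (lam : gT -> F) :
  (forall b, b \in C -> \sum_(a in C) lam a * (killing_coef G C a b)%:R = 0) ->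
  forall x y, x \in C -> y \in C -> \sum_(b in C | (x ^ b)%g == y) lam b = 0.
Proof.
move=> null x0 y0 x0C y0C.
pose S (x y : gT) : F := \sum_(b in C | (x ^ b)%g == y) lam b.
pose mu (b : gT) := (lam b^-1%g)^*.
have SE (x y : gT) : S x y = \sum_(a in C) lam a * ((x ^ a)%g == y)%:R.
  by rewrite /S big_mkcondr; apply: eq_bigr => a _; case: eqP; rewrite ?mulr1 ?mulr0.
have SC (x y : gT) : (S x y)^* = \sum_(b in C) mu b * ((y ^ b)%g == x)%:R.
  rewrite SE rmorph_sum (reindex_inj invg_inj) /=.
  apply: eq_big => [b|b bC]; first by apply/idP/idP => /CV; rewrite ?invgK.
  rewrite rmorphM rmorph_nat /mu; congr (_ * (_ : bool)%:R).
  by rewrite -(inj_eq (conjg_inj b)) conjgKV eq_sym.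
have tot : \sum_(x in C) \sum_(y in C) S x y * (S x y)^* = 0.
  transitivity (\sum_(b in C) mu b *
    (\sum_(a in C) lam a * (killing_coef G C a b)%:R)); last first.
    by rewrite big1 // => b bC; rewrite null // mulr0.
  under eq_bigr do under eq_bigr do rewrite SC SE big_distrlr /=.
  under eq_bigr do rewrite exchange_big.
  rewrite exchange_big /=.
  under [RHS]eq_bigr do rewrite mulr_sumr.
  rewrite [RHS]exchange_big; apply: eq_bigr => a aC.
  under eq_bigr do rewrite exchange_big.
  rewrite exchange_big; apply: eq_bigr => b bC.
  rewrite killing_coef_sum // !mulr_sumr; apply: eq_bigr => x _.
  rewrite !mulr_sumr; apply: eq_bigr => y _.
  by rewrite mulrCA !mulrA.
have ge0 (x y : gT) : 0 <= S x y * (S x y)^* by apply: mul_conjC_ge0.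
have tx := psumr_eq0P (fun x _ => sumr_ge0 _ (fun y _ => ge0 x y)) tot.
have /(_ y0 y0C)/eqP := psumr_eq0P (fun y _ => ge0 x0 y) (tx x0 x0C).
by rewrite mul_conjC_eq0 => /eqP.
Qed.

Lemma killing_nondegenerate_of_coset_sums :
  (forall lam : gT -> F,
    (forall x y, x \in C -> y \in C -> \sum_(b in C | (x ^ b)%g == y) lam b = 0) ->
    forall a, a \in C -> lam a = 0) ->
  killing_nondegenerate F G C.
Proof.
move=> vanish; rewrite /killing_nondegenerate -row_free_unit.
apply: inj_row_free => v vK.
pose lam (a : gT) : F := if insub a is Some s then v 0 (enum_rank s) else 0.
have lamE i : lam (val (enum_val i)) = v 0 i by rewrite /lam valK enum_valK.
apply/rowP=> i; rewrite mxE -lamE; apply: vanish (valP (enum_val i)).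
apply: killing_null_vanish => b bC.
have := congr1 (fun w : 'rV_ _ => w 0 (enum_rank (Sub b bC : {x | x \in C}))) vK.
rewrite !mxE; apply: etrans.
rewrite (reindex_omap (val : {x | x \in C} -> gT) insub) /=; last first.
  by move=> a aC; rewrite insubT.
rewrite (eq_bigl xpredT) => [|s]; last by rewrite (valP s) valK eqxx.
rewrite (reindex (@enum_val {x | x \in C} xpredT)) /=; last first.
  exact: onW_bij (@enum_val_bij {x | x \in C}).
by apply: eq_bigr => j _; rewrite killing_mxE enum_rankK lamE.
Qed.

End Killing.

Local Open Scope nat_scope.

(** * Permutations with prescribed values *)

Section Rearrangements.

Variable T : finType.
Implicit Types (p q r z : T) (s t a b x g : {perm T}).

(** Such a g is composed of transpositions, each of which corrects one more
    value without disturbing the earlier ones. *)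
Lemma exists_perm m (u v : nat -> T) :
  (forall i j, i < m -> j < m -> (u i == u j) = (i == j)) ->
  (forall i j, i < m -> j < m -> (v i == v j) = (i == j)) ->
  exists g : {perm T}, forall i, i < m -> g (u i) = v i.
Proof.
elim: m => [|m IH] uI vI; first by exists 1%g.
have [g gE] := IH (fun i j li lj => uI i j (ltnW li) (ltnW lj))
                  (fun i j li lj => vI i j (ltnW li) (ltnW lj)).
exists (g * tperm (g (u m)) (v m))%g => i; rewrite ltnS leq_eqVlt permM.
case/orP=> [/eqP ->|li]; first by rewrite tpermL.
rewrite tpermD; first exact: gE.
  by rewrite (inj_eq perm_inj) uI // ?(ltnW li) //; lia.
by rewrite gE // vI //; lia.
Qed.

Definition cyc3 p q r : {perm T} := (tperm p q * tperm p r)%g.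

Lemma cyc3E p q r : uniq [:: p; q; r] ->
  [/\ cyc3 p q r p = q, cyc3 p q r q = r, cyc3 p q r r = p
    & forall z, z \notin [:: p; q; r] -> cyc3 p q r z = z].
Proof.
rewrite /= !inE negb_or andbT => /andP[/andP[pq pr] qr].
split=> [|||z]; rewrite !permM ?inE ?negb_or.
- by rewrite tpermL tpermD // eq_sym.
- by rewrite tpermR tpermL.
- by rewrite (tpermD pr qr) tpermR.
- by case/and3P=> zp zq zr; rewrite !tpermD // eq_sym.
Qed.

Lemma cyc3_even p q r : uniq [:: p; q; r] -> ~~ odd_perm (cyc3 p q r).
Proof.
rewrite /= !inE negb_or andbT => /andP[/andP[pq pr] qr].
by rewrite odd_permM !odd_tperm pq pr.
Qed.

End Rearrangements.

(** * Cycles traced by periodic sequences *)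

Section Cycles.

Variable T : finType.
Implicit Types (s t a b x g : {perm T}) (f h : nat -> T) (p q : T) (m k : nat).

Lemma eqn_mod_addr_dvd m i k : (i + k == i %[mod m]) = (m %| k).
Proof. by rewrite eqn_mod_dvd ?leq_addr // addKn. Qed.

Lemma modn_addl_cancel m i j : 0 < m -> i + (j + m.-1 * i) = j %[mod m].
Proof.
case: m => // m _; have -> : i + (j + m * i) = i * m.+1 + j by nia.
by rewrite modnMDl.
Qed.

(** An m-cycle is described by an m-periodic sequence of points indexed by all
    natural numbers, so that shifting the starting point is just adding to the
    index.  For m = 1 this is the identity. *)
Definition traces m s f : Prop :=
  [/\ forall i j, (f i == f j) = (i == j %[mod m]),
      forall i, s (f i) = f i.+1 &
      forall p, s p != p -> exists i, p = f i].

Lemma is_cycle_traces m s : 0 < m -> is_cycle m s -> exists f, traces m s f.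
Proof.
move=> m0 [c [Uc sz sE]].
case: c Uc sz sE => [|c0 c] Uc sz sE; first by rewrite -sz in m0.
have lt i : i %% m < size (c0 :: c) by rewrite sz ltn_mod.
exists (fun i => nth c0 (c0 :: c) (i %% m)); split=> [i j|i|p].
- by rewrite nth_uniq.
- rewrite sE next_nth mem_nth // index_uniq //.
  have := lt i; rewrite sz => lti; rewrite -addn1 -modnDml addn1.
  case: (ltnP (i %% m).+1 m) => [l|l]; first by rewrite [in RHS]modn_small.
  have {}lti : (i %% m).+1 = m by apply/eqP; rewrite eqn_leq lti l.
  by rewrite lti modnn nth_default // -ltnS lti -sz.
- rewrite sE => np; have pc : p \in c0 :: c.
    apply/negPn/negP=> /negPf pc; move: np.
    by rewrite next_nth pc eqxx.
  exists (index p (c0 :: c)); rewrite modn_small ?nth_index //.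
  by rewrite -sz index_mem.
Qed.

Lemma traces_conj m s f g : traces m s f -> traces m (s ^ g)%g (fun i => g (f i)).
Proof.
case=> fI sf sfix; split=> [i j|i|p np].
- by rewrite (inj_eq perm_inj) fI.
- by rewrite permJ sf.
- case: (sfix ((g^-1)%g p)) => [|i fi].
    apply: contraNneq np => e.
    by rewrite -{1}(permKV g p) permJ e permKV.
  by exists i; rewrite -fi permKV.
Qed.

Lemma traces_mod m s f i j : traces m s f -> i = j %[mod m] -> f i = f j.
Proof. by case=> fI _ _ e; apply/eqP; rewrite fI; apply/eqP. Qed.

Lemma traces_moves m s f i : 1 < m -> traces m s f -> s (f i) != f i.
Proof.
by move=> m1 [fI sf _]; rewrite sf fI -addn1 eqn_mod_addr_dvd dvdn1 gtn_eqF.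
Qed.

Lemma traces_inj m s t f : traces m s f -> traces m t f -> s = t.
Proof.
move=> [_ sf sfix] [_ tf tfix]; apply/permP=> p.
have [sp|/sfix[i ->]] := altP (s p =P p); last by rewrite sf tf.
have [tp|/tfix[i e]] := altP (t p =P p); first by rewrite sp.
by rewrite e sf tf.
Qed.

Lemma traces_shift m s f k :
  0 < m -> traces m s f -> traces m s (fun i => f (i + k)).
Proof.
move=> m0 tr; have [fI sf sfix] := tr; split=> [i j|i|p np].
- by rewrite fI eqn_modDr.
- by rewrite sf addSn.
- have [i ->] := sfix p np; exists (i + m.-1 * k); apply: (traces_mod tr).
  by rewrite addnC modn_addl_cancel.
Qed.

Lemma traces_ext m s f h : f =1 h -> traces m s f -> traces m s h.
Proof.
move=> e [fI sf sfix]; split=> [i j|i|p np]; rewrite -?e //.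
by have [i ->] := sfix p np; exists i.
Qed.

(** One step less than a full turn already determines an m-cycle: t moves the
    point f 0, its orbit has m elements, and the first m of them are known. *)
Lemma traces_eq_prefix m s t f f' : 1 < m -> traces m s f -> traces m t f' ->
  (forall i, i.+1 < m -> t (f i) = f i.+1) -> t = s.
Proof.
move=> m1 trs trt tf.
have [fI sf _] := trs; have [fI' tf' tfix] := trt.
have [j fj] : exists j, f 0 = f' j.
  by apply: tfix; rewrite tf // -sf (traces_moves _ m1 trs).
have fE i : f i = f' (i + j).
  have lt i' : i' < m -> f i' = f' (i' + j).
    elim: i' => [_|i' IH l]; first by rewrite fj.
    by rewrite -tf // IH ?tf' // ltnW.
  rewrite (traces_mod (j := i %% m) trs) ?modn_mod // lt ?ltn_mod ?(ltnW m1) //.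
  by apply: (traces_mod trt); rewrite modnDml.
apply: (@traces_inj m _ _ f) => //.
apply: (@traces_ext _ _ (fun i => f' (i + j))) => [i|]; first by rewrite fE.
by apply: traces_shift => //; apply: ltnW.
Qed.

(** The nontrivial orbit of b has odd length, so it is also an orbit of the
    square of b.  This makes an interchange of two points as good as a fixed
    point. *)
Lemma odd_cycle_sqfix m b f p : odd m -> traces m b f -> b (b p) = p -> b p = p.
Proof.
move=> om [fI bf bfix] bbp; apply/eqP/negPn/negP => np.
have [i e] := bfix p np; move: np bbp; rewrite e !bf.
move=> /negP n1 /eqP; rewrite fI -addn2 eqn_mod_addr_dvd => d2; apply: n1.
have cm : coprime m 2 by rewrite coprimen2.
by rewrite fI -addn1 eqn_mod_addr_dvd -(Gauss_dvdr 1 cm).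
Qed.

(** The image of each of the two sequences has exactly m elements. *)
Lemma traces_im m s t f h : 0 < m -> traces m s f -> traces m t h ->
  (forall i, exists j, h i = f j) -> forall j, exists i, f j = h i.
Proof.
move=> m0 trs trt sub j.
have [fI _ _] := trs; have [hI _ _] := trt.
pose F := [set f i | i : 'I_m]; pose H := [set h i | i : 'I_m].
have inj (g0 : nat -> T) : (forall i j, (g0 i == g0 j) = (i == j %[mod m])) ->
  #|[set g0 i | i : 'I_m]| = m.
  move=> gI; rewrite card_imset ?card_ord // => i i' /eqP.
  by rewrite gI !modn_small // => /eqP/val_inj.
have inF i : f i \in F.
  apply/imsetP; exists (Ordinal (ltn_pmod i m0)) => //=.
  by apply: (traces_mod trs); rewrite modn_mod.
have HF : H \subset F.
  by apply/subsetP=> _ /imsetP[i _ ->]; have [i' ->] := sub i.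
have /eqP E : H == F by rewrite eqEcard HF (inj _ fI) (inj _ hI) /=.
by have := inF j; rewrite -E => /imsetP[i _ ->]; exists i.
Qed.

(** Both b and a carry the cycle x to the same cycle, so on the points of x
    they differ by a rotation. *)
Lemma conj_shift m a b x h : 1 < m -> traces m x h -> (x ^ b = x ^ a)%g ->
  exists2 k, k < m & forall i, b (h i) = a (h (i + k)).
Proof.
move=> m1 trx e.
have trb := traces_conj b trx; have tra := traces_conj a trx.
have [k ek] : exists k, b (h 0) = a (h k).
  case: tra => _ _; apply; rewrite -e.
  exact: (traces_moves _ m1 trb).
exists (k %% m); first by rewrite ltn_mod ltnW.
move=> i; rewrite (traces_mod (i := i + k %% m) (j := i + k) trx); last by rewrite modnDmr.
elim: i => [|i IH]; first by rewrite ek.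
have [_ hb _] := trb; have [_ ha _] := tra.
by rewrite -hb e IH ha addSn.
Qed.

Lemma shift_conj m a b x h k : 0 < m -> traces m x h ->
  (forall i, b (h i) = a (h (i + k))) -> (x ^ b = x ^ a)%g.
Proof.
move=> m0 trx e; apply: (@traces_inj m _ _ (fun i => b (h i))).
  exact: traces_conj.
apply: (@traces_ext _ _ (fun i => a (h (i + k)))) => [i|]; first by rewrite e.
exact: (traces_shift (f := fun i => a (h i)) k m0 (traces_conj a trx)).
Qed.

Lemma shift_eq_period m x s t h k : 0 < m -> traces m x h ->
  (forall i, i < m -> t (h i) = s (h (i + k))) ->
  forall i, t (h i) = s (h (i + k)).
Proof.
move=> m0 trx e i; rewrite (traces_mod (i := i) (j := i %% m) trx) ?modn_mod //.
rewrite e ?ltn_mod //; congr (s _); apply: (traces_mod trx).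
by rewrite modnDml.
Qed.

End Cycles.

(** * Relabellings that rule out shifts *)

Section Shifts.

Variable T : finType.
Implicit Types (a b x : {perm T}) (f h : nat -> T) (m k : nat).

(** Let a be traced by f and x by h i = f (pi i) for i < m.  The permutation
    b = a o x^k satisfies b (h i) = f ((pi (i + k)).+1), so the test says that
    b maps h i to h j and h j to h i, where i = j is allowed. *)
Definition broken m (pi : nat -> nat) k : bool :=
  has (fun i => has (fun j =>
    ((pi ((i + k) %% m)).+1 == pi j %[mod m])
    && ((pi ((j + k) %% m)).+1 == pi i %[mod m])) (iota 0 m)) (iota 0 m).

(** If a o x^k were the identity on the points of x for some k, then a would be
    a power of x there, and the steps of a, measured along x, would all be
    equal.  The step at index 0 is d; the step at some other index j is not. *)
Definition scrambled m (pi : nat -> nat) : Prop :=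
  exists d, [/\ d < m, (pi 0).+1 = pi d %[mod m] &
    exists2 j, j < m & (pi j).+1 <> pi ((j + d) %% m) %[mod m]].

(** If k is broken, then b fixes a point h i.  If b moved some other point of x,
    then, as b permutes the m points of x, its only nontrivial orbit would be
    made of all of them, including h i.  So b fixes all of them, against the
    assumption that pi is scrambled. *)
Lemma unbroken_shift m pi a x b f h f' : odd m -> 1 < m -> scrambled m pi ->
  traces m a f -> traces m x h -> traces m b f' ->
  (forall i, i < m -> h i = f (pi i)) -> (x ^ b = x ^ a)%g ->
  exists k, [/\ k < m, ~~ broken m pi k & forall i, b (h i) = a (h (i + k))].
Proof.
move=> om m1 [d [dm pid [jd jdm scr]]] tra trx trb hE e.
have m0 : 0 < m := ltnW m1.
have [k km bh] := conj_shift m1 trx e.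
exists k; split=> //; apply/negP=> /hasP[ i]; rewrite mem_iota /= add0n => im.
case/hasP=> j; rewrite mem_iota /= add0n => jm /andP[/eqP ij /eqP ji].
have [fI af _] := tra; have [hI _ _] := trx; have [_ bf bfix] := trb.
have step i' j' : j' < m -> (pi ((i' + k) %% m)).+1 = pi j' %[mod m] ->
    b (h i') = h j'.
  move=> j'm e'; rewrite bh.
  rewrite (traces_mod (i := i' + k) (j := (i' + k) %% m) trx) ?modn_mod //.
  by rewrite hE ?ltn_mod // af (traces_mod tra e') hE.
have bhi : b (h i) = h i.
  apply: (odd_cycle_sqfix om trb).
  by rewrite (step _ _ jm ij) (step _ _ im ji).
have hf i' : exists j', h i' = f j'.
  exists (pi (i' %% m)); rewrite -hE ?ltn_mod //.
  by apply: (traces_mod trx); rewrite modn_mod.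
have fh := traces_im m0 tra trx hf.
have bfx l : b (h l) = h l.
  (* otherwise the cycle b lies inside the image of h, hence fills it *)
  apply/eqP/negPn/negP => /bfix[j' hj'].
  have imb n : exists i', f' (j' + n) = h i'.
    elim: n => [|n [i' IH]]; first by exists l; rewrite addn0.
    rewrite addnS -bf IH bh; have [j1 ->] := hf (i' + k).
    by rewrite af; apply: fh.
  have imb' n : exists i', f' n = h i'.
    have [i' E] := imb (n + m.-1 * j'); exists i'; rewrite -E.
    apply: (traces_mod trb).
    by rewrite modn_addl_cancel.
  have [j1 E1] := traces_im m0 trx trb imb' i.
  by have := traces_moves j1 m1 trb; rewrite -E1 bhi eqxx.
have ah l : a (h (l + k)) = h l by rewrite -bh bfx.
have a0 : a (h 0) = h d by rewrite hE // af (traces_mod tra pid) -hE.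
have dk : d + k = 0 %[mod m].
  by apply/eqP; rewrite -hI; apply/eqP/(@perm_inj _ a); rewrite ah a0.
apply: scr; apply/eqP; rewrite -fI -af -!hE ?ltn_mod //.
apply/eqP; rewrite (traces_mod (i := (jd + d) %% m) (j := jd + d) trx); last first.
  by rewrite modn_mod.
rewrite -(ah (jd + d)); congr (a _); apply: (traces_mod trx).
by rewrite -addnA -modnDmr dk mod0n addn0.
Qed.

Lemma conj_rigid m pi a x b f h f' : odd m -> 1 < m -> scrambled m pi ->
  (forall k, 0 < k < m -> broken m pi k) ->
  traces m a f -> traces m x h -> traces m b f' ->
  (forall i, i < m -> h i = f (pi i)) -> (x ^ b = x ^ a)%g -> b = a.
Proof.
move=> om m1 scr brk tra trx trb hE e.
have m0 : 0 < m := ltnW m1.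
have [[|k] [km nbr bh]] := unbroken_shift om m1 scr tra trx trb hE e; last first.
  by rewrite brk in nbr.
have hf i' : exists j', h i' = f j'.
  exists (pi (i' %% m)); rewrite -hE ?ltn_mod //.
  by apply: (traces_mod trx); rewrite modn_mod.
have [_ af _] := tra.
apply: (traces_eq_prefix m1 tra trb) => i _; rewrite -af.
by have [j ->] := traces_im m0 tra trx hf i; rewrite bh addn0.
Qed.

(** Here i' and j' stand for i + k and j + k modulo m; each congruence is
    replaced by the two equations between naturals that are possible, which
    linear arithmetic can decide. *)
Lemma brokenI m pi k i i' j j' :
  [/\ i < m, i' < m, j < m & j' < m] ->
  i + k = i' \/ i + k = i' + m -> j + k = j' \/ j + k = j' + m ->
  (pi i').+1 = pi j \/ (pi i').+1 = pi j + m ->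
  (pi j').+1 = pi i \/ (pi j').+1 = pi i + m -> broken m pi k.
Proof.
move=> [im i'm jm j'm] ei ej eij eji.
have red u v : u < m -> v = u \/ v = u + m -> v %% m = u.
  by move=> um [] ->; rewrite ?modnDr modn_small.
apply/hasP; exists i; first by rewrite mem_iota.
apply/hasP; exists j; first by rewrite mem_iota.
rewrite (red i' (i + k)) // (red j' (j + k)) //.
by case: eij eji => -> [] ->; rewrite ?modnDr !eqxx.
Qed.

End Shifts.

(** * Zigzag orders *)

(** The index in a = (f 0, f 1, ...) of the point numbered i along x.  The last
    two cases alone are the inverse of the zigzag order 0, 1, -1, 2, -2, ...,
    where -j is represented by m - j.  The indices 1, 2, 3 of the points 1, -1,
    2 are redistributed: 2 gets index 2, while 1 and -1 get al and be. *)
Definition zigzag (al be m i : nat) : nat :=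
  if i == 0 then 0 else if i == 1 then al else if i == 2 then 2
  else if i == m.-1 then be
  else if i <= m./2 then i.*2.-1 else (m - i).*2.

Definition ends (al be : nat) := al = 1 /\ be = 3 \/ al = 3 /\ be = 1.

Ltac zigzag_lia := rewrite /zigzag; repeat (case: ifP => ?); rewrite ?eqxx /=; lia.

Lemma zigzag_lt al be m i : ends al be -> odd m -> 9 <= m -> i < m ->
  zigzag al be m i < m.
Proof. rewrite /ends => ab om m9 im; zigzag_lia. Qed.

Lemma zigzag_inj al be m i j : ends al be -> odd m -> 9 <= m ->
  i < m -> j < m -> zigzag al be m i = zigzag al be m j -> i = j.
Proof. rewrite /ends => ab om m9 im jm; zigzag_lia. Qed.

(** Let h be the integer part of m / 2.  Away from the start, a maps j to -j and
    -j to j + 1.  For even k, the first kind of step (j = k / 2) gives a fixed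
    point when k >= 6 and the second when k is 2 or 4.  For odd k >= 7, if
    A + B = k with 3 <= A, B <= h, then the points -A and -B are interchanged:
    x^k maps -B to A, which a maps to -A, and likewise with A and B exchanged.
    For k = 5 two steps of the second kind do the same, except for m = 9,
    where -h -> 0 is a step of length 4.  For k = 1 and k = 3 the altered start
    of the order provides the steps -1 and -3. *)
Lemma zigzag_broken al be m k : ends al be -> odd m -> 9 <= m -> 0 < k < m ->
  broken m (zigzag al be m) k.
Proof.
move=> ab om m9 km; set h := m./2.
have mE : m = h.*2.+1 by rewrite /h; lia.
have [ek|ok] := boolP (~~ odd k).
  have [k6|k6] := leqP 6 k.
    apply: (@brokenI _ _ _ (m - k./2) k./2 (m - k./2) k./2); try split; zigzag_lia.
  apply: (@brokenI _ _ _ (h - k./2).+1 (m - (h - k./2)) (h - k./2).+1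
            (m - (h - k./2))); try split; zigzag_lia.
have [k7|k7] := leqP 7 k.
  have [kh|kh] := leqP (h + 3) k.
    apply: (@brokenI _ _ _ (m - (k - h)) h (m - h) (k - h)); try split; zigzag_lia.
  apply: (@brokenI _ _ _ (m - 3) (k - 3) (m - (k - 3)) 3); try split; zigzag_lia.
have [k5|k5] := eqVneq k 5.
  have [m11|m11] := leqP 11 m; last first.
    apply: (@brokenI _ _ _ 0 5 0 5); try split; zigzag_lia.
  apply: (@brokenI _ _ _ (h - 2) (m - (h - 2)) (h - 1) (m - (h - 3)));
    try split; zigzag_lia.
have [k3|k3] := eqVneq k 3; case: ab => -[-> ->].
- apply: (@brokenI _ _ _ m.-1 2 m.-1 2); try split; zigzag_lia.
- apply: (@brokenI _ _ _ (m - 2) 1 (m - 2) 1); try split; zigzag_lia.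
- apply: (@brokenI _ _ _ (m - 2) m.-1 (m - 2) m.-1); try split; zigzag_lia.
- apply: (@brokenI _ _ _ m.-1 0 m.-1 0); try split; zigzag_lia.
Qed.

Lemma zigzag_scrambled al be m : ends al be -> 9 <= m ->
  scrambled m (zigzag al be m).
Proof.
move=> ab m9; have lt i : i <= 8 -> i < m by move=> i8; apply: leq_trans m9.
case: ab => -[-> ->].
  exists 1; split; rewrite ?lt //; exists 2; rewrite ?lt //.
  rewrite (modn_small (lt (2 + 1) _)) //.
  have -> : zigzag 1 3 m (2 + 1) = 5 by zigzag_lia.
  by rewrite !modn_small ?lt.
exists m.-1; split; rewrite ?ltn_predL ?lt //.
  by have -> : zigzag 3 1 m m.-1 = 1 by zigzag_lia.
exists 1; rewrite ?lt // add1n prednK ?lt // modnn.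
by rewrite !modn_small ?lt.
Qed.

(** * Functions on a class of cycles with vanishing coset sums *)

Lemma uniq_rot3 (T : eqType) (p q r v w : T) :
  uniq [:: p; q; r; v; w] -> uniq [:: p; v; r; w; q].
Proof.
rewrite (perm_uniq (s2 := [:: p; v; r; w; q])) //.
by apply/seq.permP => z /=; lia.
Qed.

Lemma eq_opp3 (F : numDomainType) (x y z : F) :
  (x = - y)%R -> (y = - z)%R -> (z = - x)%R -> x = 0%R.
Proof.
move=> xy yz zx; have : (x = - x)%R by rewrite {1}xy yz opprK zx.
by move/eqP; rewrite -addr_eq0 -mulr2n mulrn_eq0 => /eqP.
Qed.

Section Vanish.

Variables (T : finType) (F : numDomainType) (m : nat) (G : {group {perm T}}).
Variables (C : {set {perm T}}) (lam : {perm T} -> F).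
Hypothesis (m_odd : odd m) (altG : ('Alt_T)%g \subset G).
Hypothesis (CJ : forall x g, x \in C -> g \in G -> (x ^ g)%g \in C).
Hypothesis (subCG : C \subset G).
Hypothesis (cycC : forall s, s \in C -> exists f, traces m s f).
Hypothesis (lam0 : forall x y, x \in C -> y \in C ->
  (\sum_(b in C | (x ^ b)%g == y) lam b = 0)%R).

Lemma evenCJ x g : x \in C -> ~~ odd_perm g -> (x ^ g)%g \in C.
Proof.
by move=> xC eg; apply: CJ => //; apply: (subsetP altG); rewrite Alt_even.
Qed.

Lemma coset_singleton_eq0 a x : a \in C -> x \in C ->
  (forall b, b \in C -> (x ^ b = x ^ a)%g -> b = a) -> lam a = 0%R.
Proof.
move=> aC xC only_a.
rewrite -(lam0 xC (CJ xC (subsetP subCG a aC))) (big_pred1 a) // => b /=.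
apply/andP/eqP => [[bC /eqP]|->]; first exact: only_a.
by rewrite aC eqxx.
Qed.

Lemma coset_pair_opp a a' x : a \in C -> a' \in C -> x \in C -> a' != a ->
  (x ^ a' = x ^ a)%g ->
  (forall b, b \in C -> (x ^ b = x ^ a)%g -> b = a \/ b = a') ->
  lam a = (- lam a')%R.
Proof.
move=> aC a'C xC ne xa' only; apply/eqP; rewrite -addr_eq0; apply/eqP.
rewrite -(lam0 xC (CJ xC (subsetP subCG a aC))).
rewrite (bigD1 a) ?aC ?eqxx //= (big_pred1 a') // => b /=.
apply/idP/eqP => [/andP[/andP[bC /eqP/(only _ bC)[]-> //]]|->].
  by rewrite eqxx.
by rewrite a'C xa' eqxx.
Qed.

(** The table is the 3-cycle of indices 3 -> 4 -> 6 -> 3, so that x is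
    conjugate to a by an even permutation; the six nontrivial shifts are
    checked by computation. *)
Lemma lam_eq0_length7 a (f : nat -> T) : m = 7 -> a \in C -> traces m a f -> lam a = 0%R.
Proof.
move=> m7 aC tra; have [fI _ _] := tra.
pose pi := nth 0 [:: 0; 1; 2; 4; 6; 5; 3].
have U : uniq [:: f 3; f 4; f 6] by rewrite /= !inE !fI m7.
have [g3 g4 g6 gn] := cyc3E U; set g := cyc3 _ _ _ in g3 g4 g6 gn.
have trx := traces_conj g tra.
apply: (@coset_singleton_eq0 a (a ^ g)%g) => // [|b bC].
  by apply: evenCJ => //; apply: cyc3_even.
have [f' trb] := cycC bC.
apply: (@conj_rigid _ m pi _ _ _ _ _ _ _ _ _ _ tra trx trb) => //.
- by rewrite m7.
- by exists 1; rewrite m7; split=> //; exists 2.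
- rewrite m7 => k; do 7?[case: k => [|k] //].
- rewrite m7 => i; do 7?[case: i => [_|i] /=] => //;
  by rewrite gn // !inE !fI m7.
Qed.

(** The two choices of (al, be) give conjugating permutations that differ by a
    transposition; the even one of them keeps x in C. *)
Lemma lam_eq0_length_ge9 a (f : nat -> T) : 9 <= m -> a \in C ->
  traces m a f -> lam a = 0%R.
Proof.
move=> m9 aC tra; have [fI _ _] := tra.
have lt i : i <= 8 -> i < m by move=> i8; apply: leq_trans m9.
have iso al be (g : {perm T}) : ends al be ->
    (forall i, i < m -> g (f i) = f (zigzag al be m i)) ->
    ~~ odd_perm g -> lam a = 0%R.
  move=> ab gE eg; have trx := traces_conj g tra.
  apply: (@coset_singleton_eq0 a (a ^ g)%g) => // [|b bC]; first exact: evenCJ.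
  have [f' trb] := cycC bC.
  apply: (@conj_rigid _ m (zigzag al be m) _ _ _ _ _ _ _ _ _ _ tra trx trb) => //.
  - exact: lt.
  - exact: zigzag_scrambled.
  - by move=> k; apply: zigzag_broken.
have e13 : ends 1 3 by left.
have e31 : ends 3 1 by right.
have [g gE] : exists g : {perm T}, forall i, i < m -> g (f i) = f (zigzag 1 3 m i).
  apply: exists_perm => i j im jm; rewrite fI !modn_small ?zigzag_lt //.
  by apply/eqP/eqP => [|->//]; apply: zigzag_inj.
have [og|] := boolP (odd_perm g); last exact: (iso _ _ g e13 gE).
apply: (iso _ _ (g * tperm (f 1%N) (f 3))%g e31) => [i im|]; last first.
  by rewrite odd_permM og odd_tperm fI !modn_small ?lt.
have zI j : j < m -> (f (zigzag 1 3 m i) == f (zigzag 1 3 m j)) = (i == j).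
  move=> jm; rewrite fI !modn_small ?zigzag_lt //.
  by apply/eqP/eqP => [|->//]; apply: zigzag_inj.
rewrite permM gE //.
have z1 : f 1 = f (zigzag 1 3 m 1) by [].
have zm : f 3 = f (zigzag 1 3 m m.-1) by congr f; zigzag_lia.
have m1m : m.-1 < m by rewrite ltn_predL lt.
have [->|i1] := eqVneq i 1; first by rewrite -z1 tpermL.
have [->|im1] := eqVneq i m.-1.
  by rewrite -zm tpermR; congr f; zigzag_lia.
rewrite tpermD.
- by congr f; move: i1 im1; zigzag_lia.
- by rewrite z1 eq_sym zI ?lt.
- by rewrite zm eq_sym zI.
Qed.

(** With x = (f 1, f 2, f 0, f 3, f 4) the shifts 2, 3 and 4 are broken and the
    shift 1 leads to the 5-cycle a' = (f 0, f 4, f 2, f 1, f 3). *)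
Lemma lam_opp_length5 a a' (f f' : nat -> T) : m = 5 -> a \in C -> a' \in C ->
  traces m a f -> traces m a' f' ->
  [/\ f' 0 = f 0, f' 1 = f 4, f' 2 = f 2, f' 3 = f 1 & f' 4 = f 3] ->
  lam a = (- lam a')%R.
Proof.
move=> m5 aC a'C tra tra' [f0 f1 f2 f3 f4]; have [fI af _] := tra.
have [fI' af' _] := tra'.
pose pi := nth 0 [:: 1; 2; 0; 3; 4].
have U : uniq [:: f 0; f 1; f 2] by rewrite /= !inE !fI m5.
have [g0 g1 g2 gn] := cyc3E U; set g := cyc3 _ _ _ in g0 g1 g2 gn.
have trx := traces_conj g tra.
have hE i : i < m -> g (f i) = f (pi i).
  rewrite m5; do 5?[case: i => [_|i] /=] => //;
  by rewrite gn // !inE !fI m5.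
have ff i : f (5 + i) = f i by apply: (traces_mod tra); rewrite m5 modnDl.
have hh : forall i, a' (g (f i)) = a (g (f (i + 1))).
  have f5 : f' 5 = f' 0 by apply: (traces_mod tra'); rewrite m5.
  apply: (shift_eq_period _ trx) => [|i im]; first by rewrite m5.
  have gf5 : g (f 5) = f 1 by rewrite -[5]addn0 ff.
  move: im; rewrite m5; do 5?[case: i => [_|i] /=] => //; rewrite addn1.
  - by rewrite !hE ?m5 //= af -f3 af' f4.
  - by rewrite !hE ?m5 //= af -f2 af' f3.
  - by rewrite !hE ?m5 //= af -f0 af' f1.
  - by rewrite !hE ?m5 //= af -f4 af' f5 f0 -[5]addn0 ff.
  - by rewrite gf5 hE ?m5 //= af -f1 af' f2.
apply: (@coset_pair_opp a a' (a ^ g)%g) => //.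
- by apply: evenCJ => //; apply: cyc3_even.
- apply/eqP=> E; have := af 0; rewrite -E -f0 af' f1; apply/eqP.
  by rewrite fI m5.
- by apply: (shift_conj _ trx hh); rewrite m5.
move=> b bC e; have [f'' trb] := cycC bC.
have scr : scrambled m pi.
  by exists 1; rewrite m5; split=> //; exists 1.
have [|k [km nbr bh]] := unbroken_shift m_odd _ scr tra trx trb hE e; first by rewrite m5.
have im n : exists j, f n = g (f j).
  apply: (traces_im _ tra trx); first by rewrite m5.
  move=> j; exists (pi (j %% m)); rewrite -hE ?ltn_mod ?m5 //.
  by congr (g _); apply: (traces_mod tra); rewrite m5 modn_mod.
have {km nbr} [k0|k1] : k = 0 \/ k = 1.
  move: km nbr {bh}; rewrite m5.
  by do 5?[case: k => [|k]] => //; [left|right].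
- left; apply: (traces_eq_prefix _ tra trb); first by rewrite m5.
  by move=> i _; rewrite -af; have [j ->] := im i; rewrite bh k0 addn0.
- right; apply: (traces_eq_prefix _ tra' trb); first by rewrite m5.
  have agree n : b (f n) = a' (f n) by have [j ->] := im n; rewrite bh k1 hh.
  move=> i; rewrite m5 -af'; do 4?[case: i => [_|i]] => //;
    by rewrite ?f0 ?f1 ?f2 ?f3 agree.
Qed.

(** The passage from a to a' is conjugation by the 3-cycle f 1 -> f 4 -> f 3. *)
Lemma lam_eq0_length5 a (f : nat -> T) : m = 5 -> a \in C -> traces m a f -> lam a = 0%R.
Proof.
move=> m5 aC tra; have [fI _ _] := tra.
have U : uniq [:: f 1; f 4; f 3] by rewrite /= !inE !fI m5.
have [g1 g4 g3 gn] := cyc3E U; set g := cyc3 _ _ _ in g1 g4 g3 gn.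
have g0 : g (f 0) = f 0 by rewrite gn // !inE !fI m5.
have g2 : g (f 2) = f 2 by rewrite gn // !inE !fI m5.
have eg : ~~ odd_perm g by apply: cyc3_even.
have tr1 := traces_conj g tra; have C1 := evenCJ aC eg.
have tr2 := traces_conj g tr1; have C2 := evenCJ C1 eg.
have E1 := lam_opp_length5 m5 aC C1 tra tr1.
have E2 := lam_opp_length5 m5 C1 C2 tr1 tr2.
have E3 := lam_opp_length5 m5 C2 aC tr2 tra.
by apply: (eq_opp3 (E1 _) (E2 _) (E3 _)); split; rewrite ?(g0, g1, g2, g3, g4).
Qed.

(** Write a = (u, p, q) and a' = (u, v, q), and take x = (u, p, v).  The three
    candidates on the points of x send (u, p, v) to (p, q, v), (q, v, p) and
    (v, p, q).  The first is only extended by a and the last only by a'; the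
    middle one would interchange p and v.  The point w is there to make x
    conjugate to a by the even permutation q -> v -> w -> q. *)
Lemma lam_opp_length3 a a' (f f' : nat -> T) w : m = 3 -> a \in C -> a' \in C ->
  traces m a f -> traces m a' f' -> f' 0 = f 0 -> f' 2 = f 2 ->
  uniq [:: f 0; f 1; f 2; f' 1; w] -> lam a = (- lam a')%R.
Proof.
move=> m3 aC a'C tra tra' f0 f2 U; have [fI af afix] := tra.
have [fI' af' a'fix] := tra'.
set v := f' 1 in U *.
have Uc : uniq [:: f 2; v; w].
  by move: U => /= /and5P[_ _ -> -> _].
have [g2 gv gw gn] := cyc3E Uc; set g := cyc3 _ _ _ in g2 gv gw gn.
move: U; rewrite /= !inE !negb_or => /and5P[/and4P[n01 n02 n0v n0w]].
move=> /and3P[n12 n1v n1w] /andP[n2v n2w] nvw _.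
have g0 : g (f 0) = f 0 by rewrite gn // !inE !negb_or n02 n0v n0w.
have g1 : g (f 1) = f 1 by rewrite gn // !inE !negb_or n12 n1v n1w.
have trx := traces_conj g tra.
have ff i : f (3 + i) = f i by apply: (traces_mod tra); rewrite m3 modnDl.
have nv i : f i != v.
  rewrite (traces_mod (j := i %% m) tra) ?modn_mod //.
  have := ltn_pmod i (isT : 0 < 3); rewrite m3.
  by case: (i %% 3) => [|[|[|]]].
have av : a v = v.
  by apply/eqP/negPn/negP => /afix[i e]; have := nv i; rewrite e eqxx.
have a'1 : a' (f 1) = f 1.
  apply/eqP/negPn/negP => /a'fix[i e]; move: n01 n1v n12.
  rewrite e (traces_mod (j := i %% m) tra') ?modn_mod //.
  have := ltn_pmod i (isT : 0 < 3); rewrite m3.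
  by case: (i %% 3) => [|[|[|]]] //= _; rewrite ?f0 ?f2 eqxx.
have a0 := af 0; have a1 := af 1.
have a'0 := af' 0; have a'v := af' 1; rewrite f2 in a'v; rewrite f0 in a'0.
have h3 : g (f 3) = g (f 0) by rewrite (ff 0).
have h4 : g (f 4) = g (f 1) by rewrite (ff 1).
have hh : forall i, a' (g (f i)) = a (g (f (i + 2))).
  apply: (shift_eq_period _ trx) => [|i im]; first by rewrite m3.
  move: im; rewrite m3; do 3?[case: i => [_|i] /=] => //.
  - by rewrite g0 add0n g2 av a'0.
  - by rewrite addn2 h3 g0 g1 a'1 a0.
  - by rewrite addn2 h4 g1 g2 a1 a'v.
apply: (@coset_pair_opp a a' (a ^ g)%g) => //.
- by apply: evenCJ => //; apply: cyc3_even.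
- by apply/eqP=> E; move: n1v; rewrite -a0 /v -a'0 E eqxx.
- by apply: (shift_conj _ trx hh); rewrite m3.
move=> b bC e; have [f'' trb] := cycC bC.
have [|k km bh] := conj_shift _ trx e; first by rewrite m3.
have := bh 0; have := bh 1; have := bh 2.
move: km; rewrite m3 g0 g1 g2; case: k bh => [|[|[|]]] //= bh _ b2 b1 b0.
- left; apply: (traces_eq_prefix _ tra trb); first by rewrite m3.
  rewrite m3 => -[|[|]] // _; first by rewrite b0 addn0 g0 a0.
  by rewrite b1 addn0 g1.
- have bb : b (b (f 1)) = f 1.
    by rewrite b1 g2 av -g2 bh h3 g0 a0.
  have := odd_cycle_sqfix m_odd trb bb; rewrite b1 g2 av => E.
  by move: n1v; rewrite E eqxx.
- right; apply: (traces_eq_prefix _ tra' trb); first by rewrite m3.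
  rewrite m3 => -[|[|]] // _; first by rewrite f0 b0 g2 av.
  by rewrite -/v b2 h4 g1 a1 f2.
Qed.

(** With two further points v and w, conjugation by f 1 -> v -> w -> f 1 carries
    a = (f 0, f 1, f 2) to (f 0, v, f 2), then to (f 0, w, f 2) and back. *)
Lemma lam_eq0_length3 a (f : nat -> T) : 5 <= #|T| -> m = 3 -> a \in C -> traces m a f ->
  lam a = 0%R.
Proof.
move=> T5 m3 aC tra; have [fI _ _] := tra.
have U3 : uniq [:: f 0; f 1; f 2] by rewrite /= !inE !fI m3.
have [v [w U]] : exists v w, uniq [:: v; w; f 0; f 1; f 2].
  have ex (s : seq T) : size s < #|T| -> exists v, v \notin s.
    move=> ls; apply/existsP; rewrite -negb_forall; apply/negP => /forallP all.
    have := max_card (mem s); have := card_size s.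
    have -> : #|s| = #|T| by apply: eq_card => z; rewrite !inE; exact: all.
    by rewrite leqNgt ls.
  have [w wn] := ex [:: f 0; f 1; f 2] (leq_trans (isT : 3 < 5) T5).
  have [v vn] := ex [:: w; f 0; f 1; f 2] (leq_trans (isT : 4 < 5) T5).
  by exists v, w; rewrite cons_uniq vn cons_uniq wn.
have nU : uniq [:: f 1; v; w].
  move: U; rewrite /= !inE !negb_or => /and5P[/and4P[vw _ v1 _] /and3P[_ w1 _] _ _ _].
  by rewrite vw ![f 1 == _]eq_sym v1 w1.
have [g1 gv gw gn] := cyc3E nU; set g := cyc3 _ _ _ in g1 gv gw gn.
have eg : ~~ odd_perm g by apply: cyc3_even.
have tr1 := traces_conj g tra; have C1 := evenCJ aC eg.
have tr2 := traces_conj g tr1; have C2 := evenCJ C1 eg.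
have g0 : g (f 0) = f 0.
  apply: gn; move: U; rewrite /= !inE !negb_or ![f 0 == _]eq_sym.
  by move=> /and5P[/and4P[_ -> _ _] /and3P[-> _ _]] /andP[]; rewrite eq_sym => ->.
have g2 : g (f 2) = f 2.
  apply: gn; move: U; rewrite /= !inE !negb_or ![f 2 == _]eq_sym.
  by move=> /and5P[/and4P[_ _ _ ->] /and3P[_ _ ->]] _ ->.
have U1 : uniq [:: f 0; f 1; f 2; v; w].
  by rewrite (perm_uniq (s2 := [:: v; w; f 0; f 1; f 2])) //
             (perm_catC [:: f 0; f 1; f 2] [:: v; w]).
have U2 := uniq_rot3 U1; have U3' := uniq_rot3 U2.
apply: (@eq_opp3 _ _ (lam (a ^ g)%g) (lam ((a ^ g) ^ g)%g)).
- by apply: (lam_opp_length3 (w := w) m3 aC C1 tra tr1); rewrite ?(g0, g1, g2).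
- by apply: (lam_opp_length3 (w := f 1) m3 C1 C2 tr1 tr2); rewrite ?(g0, g1, g2, gv).
- by apply: (lam_opp_length3 (w := v) m3 C2 aC tr2 tra); rewrite ?(g0, g1, g2, gv).
Qed.

Lemma lam_eq0 a : 5 <= #|T| -> 3 <= m -> a \in C -> lam a = 0%R.
Proof.
move=> T5 m3 aC; have [f tra] := cycC aC.
have [m9|m9] := leqP 9 m; first exact: lam_eq0_length_ge9 tra.
have [m7|m7] := eqVneq m 7; first exact: lam_eq0_length7 tra.
have [m5|m5] := eqVneq m 5; first exact: lam_eq0_length5 tra.
by apply: (lam_eq0_length3 T5 _ aC tra); lia.
Qed.

End Vanish.

Theorem theorem1p6 (R : realType) (n m : nat)
  (n_ge5 : (5 <= n)%N) (m_odd : odd m) (m_bounds : (3 <= m <= n)%N)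
  (G : {group {perm 'I_n}})
  (G_sym_or_alt : G = ('Sym_('I_n))%G \/ G = ('Alt_('I_n))%G)
  (C : {set {perm 'I_n}})
  (C_class : C \in classes G)
  (C_cycles : forall s : {perm 'I_n}, s \in C -> is_cycle m s)
  (C_real : real_class C) :
  killing_nondegenerate (complex R) G C.
Proof.
have [m3 _] := andP m_bounds.
have CJ x g : x \in C -> g \in G -> (x ^ g)%g \in C.
  case/imsetP: C_class => z _ -> /imsetP[h hG ->] gG.
  by rewrite -conjgM memJ_class // groupM.
have subCG : C \subset G.
  by case/imsetP: C_class => z zG ->; apply: class_subG.
have altG : ('Alt_('I_n))%g \subset G.
  by case: G_sym_or_alt => ->; rewrite ?subsetT.
apply: killing_nondegenerate_of_coset_sums => // lam lam0 a aC.
apply: (lam_eq0 m_odd altG CJ subCG _ lam0) => //; last by rewrite card_ord.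
by move=> s sC; apply: is_cycle_traces (C_cycles s sC); apply: leq_trans m3.
Qed.
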